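(* Let $G=(V,E)$ be a connected undirected graph on $n$ nodes, let $N_i$ denote the set of neighbours of node $i$, let $K>0$, and let $\bar w_1,\dots,\bar w_n\in\mathbb{R}$ satisfy $\sum_i\bar w_i=0$. Consider solutions $\vec\phi^t\in\mathbb{R}^n$, $t\ge0$, of $$\dot\phi_i=\bar w_i+\frac{K}{n}\sum_{k\in N_i}\sin(\phi_k-\phi_i),\qquad i=1,\dots,n,$$ with initial phases satisfying $\sum_{i=1}^n\phi_i^0=0$. Let $D_0=\max_i\phi_i^0-\min_i\phi_i^0$, $\mathcal{E}_0=\sum_{i=1}^n(\phi_i^0)^2$, $\sigma(\bar w)=\sqrt{\sum_{i=1}^n\bar w_i^2}$, and $L=\bigl(1+\sum_{(k,l)\in E^c}\mathrm{dist}(k,l)\bigr)^{-1}$, where $E^c$ is the set of unordered pairs of distinct nodes that are not edges of $G$ and $\mathrm{dist}(k,l)$ is the shortest-path distance in $G$. Let $D$ be a constant with $0<D_0\le D<\pi$ and suppose $\mathcal{E}_0<D^2$. For each pair of distinct oscillators $k,l$, let $m_{kl}$ be the optimal (minimal) value of $$\text{minimize }\ \sum_{i\in N_k}\sin(\phi_k-\phi_i)+\sum_{j\in N_l}\sin(\phi_j-\phi_l)\ \text{ over }\vec\phi\in\mathbb{R}^n$$ subject to $\phi_k=\phi_l+D$, $\sum_{m=1}^n\phi_m=0$, $\sum_{m=1}^n\phi_m^2\le\mathcal{E}_0$, and $\phi_l\le\phi_m\le\phi_k$ for all $m=1,\dots,n$; let $K^*_{kl}=\frac{n\,|\bar w_k-\bar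 w_l|}{m_{kl}}$ and $K^*=\max_{k,l}K^*_{kl}$. If $K\ge K^*$ and $$K\ge\frac{\sigma(\bar w)\, D}{\sqrt{\mathcal{E}_0}\,L\,\sin D},$$ then $\max_i\phi_i^t-\min_i\phi_i^t\le D$ for all $t\ge0$ (so the set $\{\vec\phi:\max_{i,j}|\phi_i-\phi_j|\le D,\ \sum_i\phi_i=0\}$ is positively invariant for this solution), and the system achieves frequency synchronization, i.e. the solution approaches the set $\{\vec\phi:\dot\phi_i=0,\ 1\le i\le n\}$.
   Context: This is the Kuramoto model in a frame rotating with the mean natural frequency: $\bar w_i=w_i-\frac1n\sum_k w_k$. Along solutions $\sum_i\phi_i^t$ is constant, hence $0$ for all $t$. Frequency synchronization means convergence of the solution to the set of equilibria of this system. *)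

(* Defs.v *)
From HB Require Import structures.
From mathcomp Require Import all_boot all_order all_algebra.
From mathcomp Require Import all_classical all_reals all_analysis.
Set Implicit Arguments. Unset Strict Implicit. Unset Printing Implicit Defensive.
Import Order.TTheory GRing.Theory Num.Theory.
Import numFieldNormedType.Exports.
Local Open Scope classical_set_scope.
Local Open Scope ring_scope.

Definition simple_graph (n : nat) (adj : rel 'I_n) : Prop :=
  symmetric adj /\ irreflexive adj.

Definition connected_graph (n : nat) (adj : rel 'I_n) : Prop :=
  forall k l : 'I_n, connect adj k l.

Definition walk_of_length (n : nat) (adj : rel 'I_n) (k l : 'I_n) (m : nat) : bool :=
  [exists s : m.-tuple 'I_n, path adj k s && (last k s == l)].

(* shortest-path distance: least length of a walk from k to l.  In a connected
   graph on n vertices a shortest walk has length < n, so the minimum over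
   m < n is the true distance (default n is never reached). *)
Definition graph_dist (n : nat) (adj : rel 'I_n) (k l : 'I_n) : nat :=
  \big[minn/n]_(m < n | walk_of_length adj k l m) m.

Definition Lconst (R : realType) (n : nat) (adj : rel 'I_n) : R :=
  (1 + (\sum_(k < n) \sum_(l < n | (k < l)%N && ~~ adj k l)
          (graph_dist adj k l)%:R))^-1.

Definition kuramoto_rhs (R : realType) (n : nat) (adj : rel 'I_n)
    (K : R) (w : 'I_n -> R) (phi : 'I_n -> R) (i : 'I_n) : R :=
  w i + K / n%:R * \sum_(k < n | adj i k) sin (phi k - phi i).

(* max_{i,j} (phi_i - phi_j) = max_i phi_i - min_i phi_i *)
Definition spread (R : realType) (n : nat) (phi : 'I_n -> R) : R :=
  \big[Num.max/0]_(i < n) \big[Num.max/0]_(j < n) (phi i - phi j).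

Definition sumsq (R : realType) (n : nat) (phi : 'I_n -> R) : R :=
  \sum_(i < n) phi i ^+ 2.

Definition objective (R : realType) (n : nat) (adj : rel 'I_n)
    (k l : 'I_n) (phi : 'I_n -> R) : R :=
  \sum_(i < n | adj k i) sin (phi k - phi i) +
  \sum_(j < n | adj l j) sin (phi j - phi l).

Definition feasible (R : realType) (n : nat) (D E0 : R) (k l : 'I_n)
    (phi : 'I_n -> R) : Prop :=
  phi k = phi l + D /\ \sum_(m < n) phi m = 0 /\ sumsq phi <= E0 /\
  (forall m : 'I_n, phi l <= phi m <= phi k).

(* optimal value m_kl (an extended real: +oo if the problem is infeasible) *)
Definition m_opt (R : realType) (n : nat) (adj : rel 'I_n) (D E0 : R)
    (k l : 'I_n) : \bar R :=
  ereal_inf [set (objective adj k l phi)%:E | phi in feasible D E0 k l].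

Definition Kstar_kl (R : realType) (n : nat) (adj : rel 'I_n) (w : 'I_n -> R)
    (D E0 : R) (k l : 'I_n) : \bar R :=
  ((n%:R * `|w k - w l|)%:E / m_opt adj D E0 k l)%E.

Definition Kstar (R : realType) (n : nat) (adj : rel 'I_n) (w : 'I_n -> R)
    (D E0 : R) : \bar R :=
  (\big[maxe/-oo]_(k < n) \big[maxe/-oo]_(l < n | l != k)
      Kstar_kl adj w D E0 k l)%E.

(* Main.v *)
(** The invariant set is [S = {spread <= D, sum of squares <= E0, sum = 0}].  On the boundary of
    [S] the field does not point outwards: where [phi_k - phi_l = D] this is [K >= Kstar], and
    where the sum of squares is [E0] it follows from [x sin x >= (sin D / D) x^2] and the
    spectral-gap bound [n L |x|^2 <= sum over edges of (x_i - x_j)^2].  These boundary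
    inequalities are not strict, so [S] is replaced by the dilates [b(t) S] with
    [b(t) = 1 + eps exp(c t)]: scaling a boundary point of [b S] back to [S] costs at most a
    multiple of [b - 1], which the growth of [b] dominates strictly, so the solution stays in
    [b(t) S]; then let [eps] tend to [0].  Synchronization holds because the system is the
    gradient flow of a potential that is bounded along the solution: the squared velocity is
    Lipschitz in time and integrable, hence tends to [0], and compactness turns small velocity
    into closeness to an equilibrium. *)

Require Import Defs.
From HB Require Import structures.
From mathcomp Require Import all_boot all_order all_algebra.
From mathcomp Require Import all_classical all_reals all_analysis.
From mathcomp Require Import ring lra.
Import Order.TTheory GRing.Theory Num.Theory.
Import numFieldNormedType.Exports.
Local Open Scope classical_set_scope.
Local Open Scope ring_scope.

Set Implicit Arguments.
Unset Strict Implicit.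
Unset Printing Implicit Defensive.

(** * Graph distance and the spectral gap of a connected graph *)

Lemma ler_sum_uniq (R : numDomainType) (I : finType) (s : seq I) (F : I -> R) :
  uniq s -> (forall i, 0 <= F i) -> \sum_(i <- s) F i <= \sum_i F i.
Proof.
move=> us F0; rewrite [leRHS](bigID (mem s)) /= big_uniq//=.
by rewrite lerDl sumr_ge0.
Qed.

(** Cauchy-Schwarz for the telescoping sum of increments along the walk [k :: s], proved by
    induction on [s]. *)
Lemma sqr_path_le (R : realFieldType) (T : Type) (x : T -> R) (k : T) (s : seq T) :
  (x k - x (last k s)) ^+ 2 <=
  (size s)%:R * \sum_(p <- zip (k :: s) s) (x p.1 - x p.2) ^+ 2.
Proof.
elim: s k => [|y s IH] k /=; first by rewrite subrr expr0n mul0r.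
rewrite big_cons /=; move: (IH y).
set B := \sum_(_ <- _) _; set b := x y - _; move=> hb.
have -> : x k - x (last y s) = (x k - x y) + b by rewrite /b; ring.
set a := x k - x y; have B0 : 0 <= B by apply: sumr_ge0 => i _; exact: sqr_ge0.
case: s {IH} @B @b hb B0 => [|z s] B b hb B0.
  by rewrite /b /= subrr addr0 mul1r lerDl.
rewrite -natr1; set m : R := (size (z :: s))%:R.
have m0 : 0 < m by rewrite ltr0n.
rewrite -/m in hb.
(* Weighted AM-GM: after multiplication by [m] this is [0 <= (m * a - b) ^+ 2] together with the
   induction hypothesis [b ^+ 2 <= m * B]. *)
suff : 2 * a * b <= m * a ^+ 2 + B by nra.
rewrite -(ler_pM2l m0); have := sqr_ge0 (m * a - b); nra.
Qed.

(** The factor 2 arises because each step of the path occurs on the right in both orders: passing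
    from [y :: s] to [k :: y :: s] adds the pair [k, y] in the new row and [y, k] in the new
    column. *)
Lemma path_edges_le (R : realDomainType) (T : Type) (adj : rel T) (x : T -> R)
    (k : T) (s : seq T) :
  symmetric adj -> path adj k s ->
  2 * \sum_(p <- zip (k :: s) s) (x p.1 - x p.2) ^+ 2 <=
  \sum_(i <- k :: s) \sum_(j <- k :: s | adj i j) (x i - x j) ^+ 2.
Proof.
move=> sym; elim: s k => [|y s IH] k.
  by move=> _ /=; rewrite big_nil mulr0; apply: sumr_ge0 => i _;
    apply: sumr_ge0 => j _; exact: sqr_ge0.
move=> /andP[ky /IH]; rewrite -/(path _ _ _); set S := \sum_(i <- y :: s) _ => h.
rewrite [zip _ _]/= big_cons /= mulrDr.
have row i : \sum_(j <- y :: s | adj i j) (x i - x j) ^+ 2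
           <= \sum_(j <- k :: y :: s | adj i j) (x i - x j) ^+ 2.
  by rewrite [leRHS]big_cons; case: ifP => // _; rewrite lerDr sqr_ge0.
rewrite [leRHS]big_cons; set A := \sum_(j <- _ | adj k j) _.
have hA : (x k - x y) ^+ 2 <= A.
  rewrite /A big_cons; case: ifP => _; rewrite big_cons ky.
    rewrite addrCA lerDl addr_ge0 ?sqr_ge0 ?sumr_ge0// => *; exact: sqr_ge0.
  rewrite lerDl sumr_ge0// => *; exact: sqr_ge0.
have hB : (x k - x y) ^+ 2 + S <=
    \sum_(i <- y :: s) \sum_(j <- k :: y :: s | adj i j) (x i - x j) ^+ 2.
  rewrite /S big_cons [leRHS]big_cons addrA; apply: lerD.
    by rewrite [leRHS]big_cons [adj y k]sym ky -opprB sqrrN.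
  by apply: ler_sum => i _; exact: row.
by move: h hA hB; lra.
Qed.

(** A walk attaining the minimum in [graph_dist] can be shortened to one without repeated vertices,
    which is no longer than it. *)
Lemma graph_dist_uniq_path (n : nat) (adj : rel 'I_n) (k l : 'I_n) :
  connect adj k l ->
  exists2 s, [/\ path adj k s, last k s = l & uniq (k :: s)] &
    (size s <= graph_dist adj k l)%N.
Proof.
move=> /connectP[s0 /shortenP[s ps us _] ->].
set l' := last k s.
(* A path without repetition has fewer than [n] steps, so it takes part in the minimum, which is
   therefore attained by an actual walk. *)
have szs : (size s < n)%N.
  by have := max_card (mem (k :: s)); rewrite (card_uniqP us) card_ord.
have [m mw mE] : exists2 m : 'I_n, walk_of_length adj k l' m & graph_dist adj k l' = m.
  have wk : walk_of_length adj k l' (Ordinal szs).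
    by apply/existsP; exists (in_tuple s); rewrite ps eqxx.
  have [|m mP mE] := @eq_bigmin _ nat 'I_n n (Ordinal szs)
    (fun m => walk_of_length adj k l' m) (@nat_of_ord n) wk.
    by move=> m _; rewrite leEnat ltnW.
  by exists m => //; rewrite /graph_dist -mE minEnat.
case/existsP: mw => t /andP[pt /eqP lt_]; rewrite mE.
move: lt_ (size_tuple t); case/shortenP: pt => p pp up sp lp <-.
exists p => //; apply: uniq_leq_size sp; by case/andP: up.
Qed.

Lemma sum_sym_lt (R : nmodType) (n : nat) (P : rel 'I_n) (F : 'I_n -> 'I_n -> R) :
  symmetric P -> (forall i j, F i j = F j i) -> (forall i, F i i = 0) ->
  \sum_(i < n) \sum_(j < n | P i j) F i j =
  (\sum_(i < n) \sum_(j < n | (i < j)%N && P i j) F i j) *+ 2.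
Proof.
move=> Ps Fs F0; rewrite mulr2n.
rewrite [X in _ = _ + X](exchange_big_dep predT)//= -big_split/=.
apply: eq_bigr => i _.
rewrite (bigID (fun j : 'I_n => (i < j)%N)) /=; congr (_ + _).
  by apply: eq_bigl => j; rewrite andbC.
rewrite (bigID (fun j : 'I_n => (j < i)%N)) /= [X in _ + X]big1 ?addr0 => [|j].
  by apply: eq_big => [j|j _]; rewrite ?[P j i]Ps 1?Fs// -leqNgt andbC;
   case: ltngtP; rewrite ?andbF ?andbT.
by rewrite -!leqNgt -andbA => /and3P[_ a b]; have -> : i = j by apply/val_inj/eqP; rewrite eqn_leq a b.
Qed.

Lemma sum_sqr_diff (R : comRingType) (n : nat) (x : 'I_n -> R) :
  \sum_i x i = 0 -> \sum_i \sum_j (x i - x j) ^+ 2 = (n%:R * \sum_i x i ^+ 2) *+ 2.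
Proof.
move=> x0; pose E := \sum_i x i ^+ 2.
have row i : \sum_j (x i - x j) ^+ 2 = x i ^+ 2 *+ n + E.
  have -> : \sum_j (x i - x j) ^+ 2 =
      \sum_j (x i ^+ 2 + x j ^+ 2) - (x i * \sum_j x j) *+ 2.
    by rewrite mulr_sumr -sumrMnl -sumrB; apply: eq_bigr => j _; rewrite sqrrB addrAC.
  by rewrite x0 mulr0 mul0rn subr0 big_split/= sumr_const card_ord.
under eq_bigr => i _ do rewrite row.
by rewrite big_split/= sumr_const card_ord sumrMnl mulr_natl mulr2n.
Qed.

Lemma Lconst_gt0 (R : realType) (n : nat) (adj : rel 'I_n) : 0 < Lconst R adj.
Proof.
by rewrite invr_gt0 ltr_pwDl// sumr_ge0// => k _; apply: sumr_ge0.
Qed.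

(** Over all ordered pairs the squared differences sum to [2 * n%:R * sumsq x]. Adjacent pairs
    contribute [Q]; a non-adjacent unordered pair, counted in both orders, contributes at most its
    distance times [Q], by Cauchy-Schwarz along a shortest path. The total is at most
    [Q / Lconst R adj]. *)
Lemma Lconst_edges (R : realType) (n : nat) (adj : rel 'I_n) (x : 'I_n -> R) :
  simple_graph adj -> connected_graph adj -> \sum_i x i = 0 ->
  2 * n%:R * Lconst R adj * sumsq x <= \sum_i \sum_(j | adj i j) (x i - x j) ^+ 2.
Proof.
move=> [sym irr] conn x0.
set Q := \sum_i _.
have pair k l : (x k - x l) ^+ 2 * 2 <= (graph_dist adj k l)%:R * Q.
  have [s [ps ls us] sz] := graph_dist_uniq_path (conn k l).
  have := path_edges_le x sym ps; set T := \sum_(_ <- _) _; set S := \sum_(_ <- _) _.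
  (* Since the path repeats no vertex, both sums can be enlarged to all vertices without counting an
     edge twice. *)
  move=> ST; have TQ : T <= Q.
    have TQ' : T <= \sum_(i <- k :: s) \sum_(j | adj i j) (x i - x j) ^+ 2.
      apply: ler_sum => i _; rewrite big_mkcond [leRHS]big_mkcond.
      by apply: ler_sum_uniq us _ => j; case: ifP => // _; exact: sqr_ge0.
    apply: le_trans TQ' (ler_sum_uniq us _) => i.
    by apply: sumr_ge0 => j _; exact: sqr_ge0.
  have := sqr_path_le x k s; rewrite ls -/S => h.
  have S0 : 0 <= S by apply: sumr_ge0 => i _; exact: sqr_ge0.
  have szR : (size s)%:R <= (graph_dist adj k l)%:R :> R by rewrite ler_nat.
  have s0 : 0 <= (size s)%:R :> R by rewrite ler0n.
  by nra.
have Q0 : 0 <= Q by apply: sumr_ge0 => i _; apply: sumr_ge0 => j _; exact: sqr_ge0.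
have : (n%:R * sumsq x) *+ 2 <= Q / Lconst R adj.
  rewrite -(sum_sqr_diff x0).
  under eq_bigr => i _ do rewrite (bigID (adj i)) /=.
  rewrite big_split/= -/Q invrK mulrDr mulr1 lerD2l.
  rewrite (@sum_sym_lt _ _ (fun i j => ~~ adj i j)); last 3 first.
  - by move=> i j; rewrite sym.
  - by move=> i j; rewrite -opprB sqrrN.
  - by move=> i; rewrite subrr expr0n.
  rewrite -sumrMnl mulr_sumr; apply: ler_sum => i _.
  rewrite -sumrMnl mulr_sumr; apply: ler_sum => j _.
  by have := pair i j; lra.
rewrite ler_pdivlMr ?Lconst_gt0//; lra.
Qed.

(** * Slope estimates for the sine *)

Lemma sin_mvt (R : realType) (x y : R) : x <= y ->
  exists2 c, x <= c <= y & sin y - sin x = cos c * (y - x).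
Proof.
move=> xy; have ds (z : R) : is_derive z 1 (sin : R -> R) (cos z) by exact: is_derive_sin.
have cs : {within `[x, y], continuous (sin : R -> R)}.
  by apply: continuous_subspaceT; exact: continuous_sin.
have [c cI h] := MVT_segment xy (fun z _ => ds z) cs.
by exists c => //; move: cI; rewrite in_itv.
Qed.

Lemma lipschitz1_sin (R : realType) (x y : R) : `|sin x - sin y| <= `|x - y|.
Proof.
wlog lexy : x y / x <= y.
  by move=> h; case: (leP x y) => [/h//|/ltW/h]; rewrite distrC [leRHS]distrC.
have [c _] := sin_mvt lexy.
rewrite distrC => ->; rewrite normrM [leRHS]distrC ler_piMl// ler_norml.
by rewrite cos_geN1 cos_le1.
Qed.

(* [sin x / x] decreases on [(0, pi)]: compare the mean slopes of [sin] over [0, x] and [x, D]. *)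
Lemma sin_chord (R : realType) (D x : R) : D < pi -> `|x| <= D ->
  sin D * x ^+ 2 <= D * (x * sin x).
Proof.
move=> Dpi.
wlog x0 : x / 0 <= x.
  move=> h xD; case: (leP 0 x) => [/h|/ltW xle]; first exact.
  by have := h (- x); rewrite oppr_ge0 normrN sqrrN sinN mulrNN; apply.
rewrite ger0_norm// => xD.
have [c /andP[c0 cx]] := sin_mvt x0.
have [d /andP[xd dD]] := sin_mvt xD.
rewrite sin0 !subr0 => sD sx.
have cd : cos d <= cos c.
  by rewrite leNgt ltr_cos -?leNgt ?in_itv /=; lra.
have -> : sin D = sin x + cos d * (D - x) by lra.
rewrite sx -subr_ge0.
have -> : D * (x * (cos c * x)) - (cos c * x + cos d * (D - x)) * x ^+ 2 =
  x ^+ 2 * ((D - x) * (cos c - cos d)) by ring.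
by rewrite mulr_ge0 ?sqr_ge0// mulr_ge0// subr_ge0.
Qed.

(** * Barrier and Barbalat arguments on the real line *)

Lemma ltr0_derive_left (R : realType) (f : R -> R) (t d : R) :
  is_derive t 1 f d -> d < 0 -> \forall s \near t^'-, f t < f s.
Proof.
move=> [dv dE] d0.
have : h^-1 *: (f (h *: 1 + t) - f t) @[h --> 0^'] --> d by rewrite -dE; exact: dv.
move=> /(cvgr_lt _) /(_ 0 d0) [e /= e0 he].
near=> s.
have st : s < t by near: s; exact: nbhs_left_lt.
have es : t - s < e by near: s; exact: nbhs_left_ltBl.
have := he (s - t); rewrite /ball_/= sub0r normrN ltr0_norm ?subr_lt0// opprB.
move=> /(_ es); rewrite subr_eq0 lt_eqF// => /(_ isT).
by rewrite [_ *: 1]mulr1 subrK nmulr_rlt0 ?invr_lt0 ?subr_lt0// subr_gt0.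
Unshelve. all: by end_near. Qed.

(* A first crossing time of zero would need a nonnegative left derivative. *)
Lemma barrier (R : realType) (J : finType) (g dg : J -> R -> R) :
  (forall j, g j @ (0 : R)^'+ --> g j 0) ->
  (forall j (t : R), 0 < t -> is_derive t 1 (g j) (dg j t)) ->
  (forall j, g j 0 < 0) ->
  (forall j t, 0 < t -> (forall i, g i t <= 0) -> g j t = 0 -> dg j t < 0) ->
  forall t j, 0 <= t -> g j t < 0.
Proof.
move=> g0 dvg gneg hb t1 j1 t10; rewrite ltNge; apply/negP => gt1.
pose A := [set t : R | 0 <= t /\ exists j, 0 <= g j t].
have At1 : A t1 by split=> //; exists j1.
have hA : has_inf A by split; [exists t1 | exists 0 => t []].
pose t := inf A.
have t0 : 0 <= t by apply: lb_le_inf; [exists t1 | move=> x []].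
have before s i : 0 <= s -> s < t -> g i s < 0.
  move=> s0 st; rewrite ltNge; apply/negP => gs.
  have : t <= s by apply: ge_inf; [case: hA | split=> //; exists i].
  by rewrite leNgt st.
have tpos : 0 < t.
  have : \forall s \near 0^'+, forall j, g j s < 0.
    by apply: filter_forall => j; exact: (cvgr_lt _ (g0 j)).
  move=> [e /= e0 he]; apply: lt_le_trans e0 _; apply: lb_le_inf; first by exists t1.
  move=> x [x0 [j gx]]; rewrite leNgt; apply/negP => xe.
  move: x0; rewrite le_eqVlt => /orP[/eqP x0|x0].
    by move: gx; rewrite -x0 leNgt gneg.
  have := he x; rewrite /ball_/= sub0r normrN gtr0_norm// => /(_ xe x0 j).
  by rewrite ltNge gx.
have ct i : g i @ t --> g i t.
  by apply: differentiable_continuous; apply/derivable1_diffP; by have [] := dvg i t tpos.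
have gle i : g i t <= 0.
  apply: (cvgr_to_le (cvg_at_left_filter (ct i))); near=> s.
  apply/ltW/before; first by near: s; exact: nbhs_left_ge.
  by near: s; exact: nbhs_left_lt.
(* Were all [g i t] negative, continuity and finiteness of [J] would keep them negative a little
   beyond [t], so [t] would not be the infimum of [A]. *)
have [j gj] : exists j, g j t = 0.
  apply: contrapT => /forallNP gn0.
  have : \forall s \near t, forall j, g j s < 0.
    apply: (filter_forall (nbhs_filter t)) => j; apply: (cvgr_lt _ (ct j)).
    by rewrite lt_neqAle gle andbT; apply/eqP.
  move=> [e /= e0 he].
  have [x [x0 [j gx]] xte] := inf_adherent e0 hA.
  have tx : t <= x by apply: ge_inf; [case: hA | split=> //; exists j].
  have := he x; rewrite /ball_/= distrC ger0_norm ?subr_ge0// ltrBlDl => /(_ xte j).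
  by rewrite ltNge gx.
(* The negative derivative makes [g j] positive just to the left of [t], where [before] says that it
   is negative. *)
have := ltr0_derive_left (dvg j t tpos) (hb j t tpos gle gj); rewrite gj => hn.
have : \forall s \near t^'-, False; last first.
  by move=> /filter_ex[].
near=> s.
have : 0 < g j s by near: s.
apply/negP; rewrite -leNgt; apply/ltW/before; first by near: s; exact: nbhs_left_ge.
by near: s; exact: nbhs_left_lt.
Unshelve. all: by end_near. Qed.

(** [V] decreases and is bounded below, so from some time on it can lose only less than any
    prescribed amount. A later value [h t >= d] would persist, by the Lipschitz bound, above [d / 2]
    for a fixed time and make [V] lose too much. *)
Lemma barbalat (R : realType) (V h : R -> R) (M Lam : R) :
  (forall t : R, 0 < t -> is_derive t 1 V (- h t)) ->
  (forall t, 0 < t -> 0 <= h t) ->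
  (forall t, 0 < t -> M <= V t) ->
  0 < Lam ->
  (forall s t, 0 < s -> s <= t -> `|h t - h s| <= Lam * (t - s)) ->
  forall d, 0 < d -> exists2 T, 0 <= T & forall t, T < t -> h t < d.
Proof.
move=> dV h0 VM Lam0 hlip d d0.
have mvt s t : 0 < s -> s <= t -> exists2 c, s <= c <= t & V t - V s = - h c * (t - s).
  move=> s0 st.
  have [||c] := @MVT_segment R V (fun t => - h t) s t st.
  - by move=> x; rewrite in_itv/= => /andP[sx _]; apply: dV; exact: lt_trans sx.
  - apply: derivable_within_continuous => x; rewrite in_itv/= => /andP[sx _].
    by have [] := dV x (lt_le_trans s0 sx).
  by rewrite in_itv/= => cI E; exists c.
have Vdec s t : 0 < s -> s <= t -> V t <= V s.
  move=> s0 st; have [c /andP[sc _]] := mvt s t s0 st.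
  have := h0 c (lt_le_trans s0 sc); nra.
pose A := [set V t | t in [set t | 0 < t]].
have hA : has_inf A.
  by split; [exists (V 1), 1 => //=; exact: ltr01 | exists M => _ [t t0 <-]; exact: VM].
(* The time [h] needs at least to fall from [d] to [d / 2]; over it [V] would lose
   [tau * (d / 2)]. *)
pose tau := d / (2 * Lam).
have tau0 : 0 < tau by rewrite divr_gt0// mulr_gt0.
have e0 : 0 < tau * (d / 2) by rewrite mulr_gt0// divr_gt0.
have [_ [T T0 <-] VT] := inf_adherent e0 hA.
exists T; first exact: ltW.
move=> t Tt; rewrite ltNge; apply/negP => ht.
have t0 : 0 < t by exact: lt_trans Tt.
have [c /andP[tc ct] E] : exists2 c, t <= c <= t + tau & V (t + tau) - V t = - h c * (t + tau - t).
  by apply: mvt => //; rewrite lerDl ltW.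
have hc : d / 2 <= h c.
  have := hlip t c t0 tc; rewrite ler_norml => /andP[+ _].
  have : Lam * (c - t) <= Lam * tau by rewrite ler_pM2l// lerBlDl.
  have -> : Lam * tau = d / 2 by rewrite /tau; field; rewrite gt_eqF.
  lra.
have infle : inf A <= V (t + tau).
  by apply: ge_inf; [case: hA | exists (t + tau) => //=; rewrite addr_gt0].
have := Vdec T t T0 (ltW Tt).
have : tau * (d / 2) <= tau * h c by rewrite ler_pM2l.
move: E; lra.
Qed.

(** * Spread, sums of squares and sums over edges *)

Lemma spread_le (R : realType) (n : nat) (x : 'I_n -> R) (D : R) : 0 <= D ->
  (spread x <= D <-> forall i j, x i - x j <= D).
Proof.
move=> D0; split=> [h i j|h].
  apply: le_trans h; apply: le_trans (le_bigmax _ (fun i => \big[Num.max/0]_j (x i - x j)) i).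
  exact: (le_bigmax _ (fun j => x i - x j) j).
by apply/bigmax_leP; split=> // i _; apply/bigmax_leP; split.
Qed.

Lemma sumsq_spread_gt0 (R : realType) (n : nat) (x : 'I_n -> R) : 0 < spread x -> 0 < sumsq x.
Proof.
move=> sx; have s0 : 0 <= sumsq x by apply: sumr_ge0 => i _; exact: sqr_ge0.
rewrite lt_neqAle s0 andbT; apply/eqP => /esym /eqP.
rewrite psumr_eq0 => [/allP x0|i _]; last exact: sqr_ge0.
have xi0 i : x i = 0.
  by have := x0 i (mem_index_enum _); rewrite sqrf_eq0 => /eqP.
move: sx; rewrite ltNge => /negP; apply; apply/spread_le => // i j.
by rewrite !xi0 subrr.
Qed.

Lemma CauchySchwarz_sum (R : realType) (n : nat) (u v : 'I_n -> R) :
  \sum_i u i * v i <= Num.sqrt (sumsq u) * Num.sqrt (sumsq v).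
Proof.
have ss (f : 'I_n -> R) : 0 <= sumsq f by apply: sumr_ge0 => i _; exact: sqr_ge0.
have z (f g : 'I_n -> R) : sumsq f = 0 -> \sum_i f i * g i = 0.
  move=> /eqP; rewrite psumr_eq0 => [/allP f0|i _]; last exact: sqr_ge0.
  apply: big1 => i _; have := f0 i (mem_index_enum _).
  by rewrite sqrf_eq0 => /eqP ->; rewrite mul0r.
have [u0|u0] := eqVneq (sumsq u) 0; first by rewrite z// u0 sqrtr0 mul0r.
have [v0|v0] := eqVneq (sumsq v) 0.
  by under eq_bigr do rewrite mulrC; rewrite z// v0 sqrtr0 mulr0.
set a := Num.sqrt _; set b := Num.sqrt _.
have a0 : 0 < a by rewrite sqrtr_gt0 lt_def u0 ss.
have b0 : 0 < b by rewrite sqrtr_gt0 lt_def v0 ss.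
have aE : a ^+ 2 = sumsq u by rewrite sqr_sqrtr.
have bE : b ^+ 2 = sumsq v by rewrite sqr_sqrtr.
(* With [a] and [b] the norms of [u] and [v], this sum equals [2 * (a * b) * (a * b - S)], where [S]
   is the inner product. *)
have : 0 <= \sum_i (b * u i - a * v i) ^+ 2 by apply: sumr_ge0 => i _; exact: sqr_ge0.
have -> : \sum_i (b * u i - a * v i) ^+ 2 =
   b ^+ 2 * sumsq u + a ^+ 2 * sumsq v - 2 * (a * b) * \sum_i u i * v i.
  by rewrite !mulr_sumr -big_split -sumrB/=; apply: eq_bigr => i _; ring.
rewrite -aE -bE => h.
have ab : 0 < a * b by rewrite mulr_gt0.
rewrite -(ler_pM2l ab); move: h; set S := \sum_i _; nra.
Qed.

(** Summation by parts on the graph: each edge is met in both directions and sine is odd, so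
    averaging the two turns [x i] into a difference. It serves with [x] constant for the conserved
    mean, with [x = y] for the energy, and with [x] the velocity for the potential. *)
Lemma sum_mul_sin_sym (R : realType) (n : nat) (adj : rel 'I_n) (x y : 'I_n -> R) :
  symmetric adj ->
  \sum_i x i * \sum_(k | adj i k) sin (y k - y i) =
  - 2^-1 * \sum_i \sum_(k | adj i k) (x i - x k) * sin (y i - y k).
Proof.
move=> sym.
under eq_bigr => i _ do rewrite mulr_sumr.
pose S := \sum_i \sum_(k | adj i k) x i * sin (y i - y k).
have S1 : \sum_i \sum_(k | adj i k) x i * sin (y k - y i) = - S.
  rewrite -sumrN; apply: eq_bigr => i _; rewrite -sumrN; apply: eq_bigr => k _.
  by rewrite -mulrN -sinN opprB.
have S2 : \sum_i \sum_(k | adj i k) x k * sin (y i - y k) = - S.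
  rewrite -S1 [LHS](exchange_big_dep predT)//=; apply: eq_bigr => k _.
  by apply: eq_bigl => i; rewrite sym.
rewrite S1.
under [X in _ * X]eq_bigr => i _ do under eq_bigr => k _ do rewrite mulrBl.
under [X in _ * X]eq_bigr => i _ do rewrite sumrB.
rewrite sumrB S2 -/S; lra.
Qed.

(** * The Kuramoto field on the boundary of the invariant set *)

Lemma kuramoto_rhs_sum (R : realType) (n : nat) (adj : rel 'I_n) (K : R) (w x : 'I_n -> R) :
  symmetric adj -> \sum_i w i = 0 -> \sum_i kuramoto_rhs adj K w x i = 0.
Proof.
move=> sym w0; rewrite big_split/= w0 add0r -mulr_sumr.
have := sum_mul_sin_sym (fun=> 1) x sym.
under eq_bigr do rewrite mul1r.
move=> ->; rewrite [X in _ * (_ * X)]big1 ?mulr0// => i _.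
by apply: big1 => k _; rewrite subrr mul0r.
Qed.

(** The sum is half the derivative of [sumsq] along the flow. The frequencies contribute at most
    [s * r] by Cauchy-Schwarz; the coupling contributes at most [- K * L * (sin D / D) * r ^+ 2], by
    [sin_chord] on each edge and then the spectral gap. The bound on [K] says that the second
    outweighs the first. *)
Lemma kuramoto_energy (R : realType) (n : nat) (adj : rel 'I_n) (K D : R) (w x : 'I_n -> R) :
  simple_graph adj -> connected_graph adj -> 0 < K ->
  0 < D -> D < pi -> (forall i j, x i - x j <= D) -> \sum_i x i = 0 ->
  0 < sumsq x ->
  Num.sqrt (sumsq w) * D / (Num.sqrt (sumsq x) * Lconst R adj * sin D) <= K ->
  \sum_i x i * kuramoto_rhs adj K w x i <= 0.
Proof.
move=> sg conn K0 D0 Dpi xD x0 E0.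
have n0 : (0 < n)%N.
  by rewrite lt0n; apply/eqP => n0; subst n; move: E0; rewrite /sumsq big_ord0 ltxx.
have nR : 0 < n%:R :> R by rewrite ltr0n.
have sD : 0 < sin D by apply: sin_gt0_pi; rewrite D0.
have L0 := Lconst_gt0 R adj; set L := Lconst R adj in L0 *.
have r0 : 0 < Num.sqrt (sumsq x) by rewrite sqrtr_gt0.
have rE : Num.sqrt (sumsq x) ^+ 2 = sumsq x by rewrite sqr_sqrtr ?ltW.
have CS := CauchySchwarz_sum w x.
rewrite ler_pdivrMr ?mulr_gt0// => hK.
have hQ := Lconst_edges sg conn x0.
under eq_bigr do rewrite mulrDr mulrCA.
rewrite big_split/= -mulr_sumr (sum_mul_sin_sym _ _ sg.1).
set W := \sum_i x i * w i.
have WE : W <= Num.sqrt (sumsq w) * Num.sqrt (sumsq x).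
  by rewrite /W; under eq_bigr do rewrite mulrC.
set Q := \sum_i \sum_(_ | _) _ in hQ.
set P := \sum_i \sum_(_ | _) _.
have PQ : sin D * Q <= D * P.
  rewrite /P /Q !mulr_sumr; apply: ler_sum => i _; rewrite !mulr_sumr; apply: ler_sum => k _.
  by apply: sin_chord => //; rewrite ler_norml xD andbT lerNl opprB xD.
set r := Num.sqrt (sumsq x) in hK WE r0 rE *.
set s := Num.sqrt (sumsq w) in hK WE *.
rewrite -/L -rE in hQ.
have h1 : sin D * (2 * n%:R * L * r ^+ 2) <= D * P.
  by apply: le_trans PQ; rewrite ler_pM2l.
have h2 : s * D * r <= K * (r * L * sin D) * r by rewrite ler_pM2r.
have h3 : K / n%:R * (sin D * (2 * n%:R * L * r ^+ 2)) <= K / n%:R * (D * P).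
  by rewrite ler_pM2l// divr_gt0.
have h4 : K / n%:R * (sin D * (2 * n%:R * L * r ^+ 2)) = 2 * (K * (r * L * sin D) * r).
  by field; rewrite gt_eqF.
have h5 : D * W <= D * (s * r) by rewrite ler_pM2l.
rewrite -(pmulr_rle0 _ D0).
have -> : D * (W + K / n%:R * (- 2^-1 * P)) = D * W - 2^-1 * (K / n%:R * (D * P)) by ring.
rewrite h4 in h3; lra.
Qed.

(** The difference of velocities is [w k - w l] minus [K / n%:R] times the objective at [x], and the
    objective is at least [m_opt]. *)
Lemma kuramoto_gap (R : realType) (n : nat) (adj : rel 'I_n) (K D E0 : R) (w x : 'I_n -> R)
    (k l : 'I_n) :
  0 < K -> 0 < D -> D < pi -> (Kstar adj w D E0 <= K%:E)%E ->
  feasible D E0 k l x ->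
  kuramoto_rhs adj K w x k - kuramoto_rhs adj K w x l <= 0.
Proof.
move=> K0 D0 Dpi hK fx.
have n0 : (0 < n)%N := leq_ltn_trans (leq0n k) (ltn_ord k).
have nR : 0 < n%:R :> R by rewrite ltr0n.
(* All phase differences in the objective lie between 0 and [D < pi], so every sine is
   nonnegative. *)
have obj0 y : feasible D E0 k l y -> 0 <= objective adj k l y.
  move=> [ykl [_ [_ yb]]]; rewrite addr_ge0// sumr_ge0// => i _; apply: sin_ge0_pi;
    have /andP[] := yb i; lra.
have lk : l != k by apply/eqP => lk; case: fx => + _; rewrite lk; lra.
have hkl : (Kstar_kl adj w D E0 k l <= K%:E)%E.
  apply: le_trans hK; rewrite /Kstar.
  apply: le_trans (le_bigmax _ (fun k => \big[maxe/-oo%E]_(l < n | l != k) _) k).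
  exact: (le_bigmax_cond _ (fun l => Kstar_kl adj w D E0 k l) lk).
have mx : (m_opt adj D E0 k l <= (objective adj k l x)%:E)%E.
  by apply: ereal_inf_lbound; exists x.
have m0 : (0 <= m_opt adj D E0 k l)%E.
  by apply/ereal_infP => _ [y fy <-]; rewrite lee_fin obj0.
have main : n%:R * `|w k - w l| <= K * objective adj k l x.
  (* [mx] rules out the value [+oo] of [m_opt], and [m0] rules out [-oo]. *)
  move: hkl mx m0; rewrite /Kstar_kl; case: (m_opt _ _ _ _ _) => [m| |]//.
  rewrite !lee_fin inver; case: eqP => [_|/eqP m0].
    (* [0^-1 = +oo] in [\bar R], so an optimal value [0] forces [w k = w l]. *)
    move=> + _ _; have [->|wkl] := eqVneq (w k - w l) 0.
      by move=> _; rewrite normr0 mulr0 mulr_ge0// ?obj0// ltW.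
    by rewrite gt0_muley// lte_fin mulr_gt0// normr_gt0.
  rewrite -EFinM lee_fin => + mo mge; rewrite ler_pdivrMr ?lt_def ?m0// => /le_trans; apply.
  by rewrite ler_pM2l.
rewrite /kuramoto_rhs.
have -> : \sum_(i < n | adj k i) sin (x i - x k) = - \sum_(i < n | adj k i) sin (x k - x i).
  by rewrite -sumrN; apply: eq_bigr => i _; rewrite -sinN opprB.
have wn := ler_norm (w k - w l).
rewrite -(pmulr_rle0 _ nR).
set a := \sum_(i < n | adj k i) _; set b := \sum_(i < n | _) _.
have -> : n%:R * (w k + K / n%:R * - a - (w l + K / n%:R * b)) =
  n%:R * (w k - w l) - K * (a + b) by field; rewrite gt_eqF.
have : n%:R * (w k - w l) <= n%:R * `|w k - w l| by rewrite ler_pM2l.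
move: main; rewrite /objective -/a -/b; lra.
Qed.

(** * Limits and derivatives of sums, and bounds for the field *)

Lemma cvg_sumr (R : realType) (T : Type) (F : set_system T) (I : Type) (r : seq I) (P : pred I)
    (f : I -> T -> R) (a : I -> R) : Filter F ->
  (forall i, P i -> f i x @[x --> F] --> a i) ->
  \sum_(i <- r | P i) f i x @[x --> F] --> \sum_(i <- r | P i) a i.
Proof. by move=> FF fa; apply: cvg_big => //; exact: add_continuous. Qed.

Lemma is_derive_sum_fun (R : realType) (n : nat) (P : pred 'I_n) (f : 'I_n -> R -> R)
    (df : 'I_n -> R) (t : R) :
  (forall i, P i -> is_derive t 1 (f i) (df i)) ->
  is_derive t 1 (fun s => \sum_(i < n | P i) f i s) (\sum_(i < n | P i) df i).
Proof.
move=> dvf; rewrite big_mkcond.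
have -> : (fun s => \sum_(i < n | P i) f i s) = \sum_(i < n) (if P i then f i else cst 0).
  by rewrite fct_sumE; apply/funext => s; rewrite big_mkcond; apply: eq_bigr => i _; case: ifP.
by apply: is_derive_sum => i; case: ifP => [/dvf//|_]; exact: is_derive_cst.
Qed.

(** The field depends on phase differences only, sine is 1-Lipschitz, and the at most [n] terms
    cancel the factor [1 / n]. *)
Lemma kuramoto_rhs_lip (R : realType) (n : nat) (adj : rel 'I_n) (K d : R) (w x y : 'I_n -> R)
    (i : 'I_n) :
  0 <= K -> 0 <= d -> (forall k, `|(x k - x i) - (y k - y i)| <= d) ->
  `|kuramoto_rhs adj K w x i - kuramoto_rhs adj K w y i| <= K * d.
Proof.
move=> K0 d0 xy; have n0 : (0 < n)%N := leq_ltn_trans (leq0n i) (ltn_ord i).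
have nR : 0 < n%:R :> R by rewrite ltr0n.
rewrite /kuramoto_rhs opprD addrACA subrr add0r -mulrBr normrM ger0_norm ?divr_ge0//.
have -> : K * d = K / n%:R * (n%:R * d) by field; rewrite gt_eqF.
rewrite ler_wpM2l ?divr_ge0// -sumrB; apply: le_trans (ler_norm_sum _ _ _) _.
rewrite [leRHS](_ : _ = \sum_(k < n) d); last by rewrite sumr_const card_ord mulr_natl.
rewrite big_mkcond; apply: ler_sum => k _; case: ifP => // _.
exact: le_trans (lipschitz1_sin _ _) (xy k).
Qed.

Lemma kuramoto_rhs_bound (R : realType) (n : nat) (adj : rel 'I_n) (K : R) (w x : 'I_n -> R)
    (i : 'I_n) :
  0 <= K -> `|kuramoto_rhs adj K w x i| <= \sum_j `|w j| + K.
Proof.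
move=> K0; have n0 : (0 < n)%N := leq_ltn_trans (leq0n i) (ltn_ord i).
have nR : 0 < n%:R :> R by rewrite ltr0n.
apply: le_trans (ler_normD _ _) _; apply: lerD.
  by rewrite (bigD1 i)//= lerDl sumr_ge0.
rewrite normrM ger0_norm ?divr_ge0// -[leRHS](divfK (lt0r_neq0 nR)) ler_wpM2l ?divr_ge0//.
apply: le_trans (ler_norm_sum _ _ _) _.
rewrite [leRHS](_ : _ = \sum_(k < n) 1); last by rewrite sumr_const card_ord.
rewrite big_mkcond; apply: ler_sum => k _; case: ifP => // _.
by rewrite ler_norml sin_geN1 sin_le1.
Qed.

(** As the mean is zero, [n%:R * x i] is the sum over [j] of [x i - x j]. *)
Lemma sum0_norm_le (R : realFieldType) (n : nat) (x : 'I_n -> R) (D : R) :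
  (forall i j, x i - x j <= D) -> \sum_i x i = 0 -> forall i, `|x i| <= D.
Proof.
move=> xD x0 i; have n0 : (0 < n)%N := leq_ltn_trans (leq0n i) (ltn_ord i).
have nR : 0 < n%:R :> R by rewrite ltr0n.
have e : \sum_(j < n) (x i - x j) = n%:R * x i.
  by rewrite sumrB x0 subr0 sumr_const card_ord mulr_natl.
have e' : \sum_(j < n) D = n%:R * D by rewrite sumr_const card_ord mulr_natl.
rewrite ler_norml; apply/andP; split; rewrite -(ler_pM2l nR) ?mulrN -e -e' -?sumrN.
  by apply: ler_sum => j _; rewrite lerNl opprB.
by apply: ler_sum => j _.
Qed.

(** * Conservation of the mean and invariance of the spread bound *)

Lemma kuramoto_sum0 (R : realType) (n : nat) (adj : rel 'I_n) (K : R) (w : 'I_n -> R)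
    (phi : R -> 'I_n -> R) :
  symmetric adj -> \sum_i w i = 0 ->
  (forall i, (fun t => phi t i) @ (0 : R)^'+ --> phi 0 i) ->
  (forall (t : R) i, 0 < t ->
     is_derive t 1 (fun s => phi s i) (kuramoto_rhs adj K w (phi t) i)) ->
  \sum_i phi 0 i = 0 -> forall t, 0 <= t -> \sum_i phi t i = 0.
Proof.
move=> sym w0 c0 dphi p0 t; rewrite le_eqVlt => /orP[/eqP <-//|t0].
have dS (s : R) : 0 < s -> is_derive s 1 (fun s => \sum_i phi s i) 0.
  move=> s0; apply: is_derive_eq (kuramoto_rhs_sum K (phi s) sym w0).
  by apply: is_derive_sum_fun => i _; exact: dphi.
have cS (s : R) : 0 < s -> (fun s => \sum_i phi s i) @ s --> \sum_i phi s i.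
  move=> s0; apply: differentiable_continuous; apply/derivable1_diffP.
  by have [] := dS s s0.
have [||c _] := @MVT_segment R (fun s => \sum_i phi s i) (fun=> 0) 0 t (ltW t0).
- by move=> x; rewrite in_itv/= => /andP[x0 _]; exact: dS.
- apply/continuous_within_itvP => //; split.
  + by move=> x; rewrite in_itv/= => /andP[x0 _]; exact: cS.
  + by apply: cvg_sumr => i _; exact: c0.
  + by apply: cvg_at_left_filter; exact: cS.
by rewrite p0 mul0r subr0.
Qed.

Lemma kuramoto_invariant (R : realType) (n : nat) (adj : rel 'I_n) (K D : R) (w : 'I_n -> R)
    (phi : R -> 'I_n -> R) :
  simple_graph adj -> connected_graph adj -> 0 < K -> \sum_i w i = 0 ->
  (forall i, (fun t => phi t i) @ (0 : R)^'+ --> phi 0 i) ->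
  (forall (t : R) i, 0 < t ->
     is_derive t 1 (fun s => phi s i) (kuramoto_rhs adj K w (phi t) i)) ->
  \sum_i phi 0 i = 0 -> 0 < D -> D < pi -> (forall i j, phi 0 i - phi 0 j <= D) ->
  0 < sumsq (phi 0) ->
  (Kstar adj w D (sumsq (phi 0%R)) <= K%:E)%E ->
  Num.sqrt (sumsq w) * D / (Num.sqrt (sumsq (phi 0)) * Lconst R adj * sin D) <= K ->
  forall t, 0 <= t -> forall i j, phi t i - phi t j <= D.
Proof.
move=> sg conn K0 w0 c0 dphi p0 D0 Dpi pD; set E0 := sumsq (phi 0) => E00 hK1 hK2 t t0 i j.
have sum0 := kuramoto_sum0 sg.1 w0 c0 dphi p0.
(* The growth rate of the dilation: [2 * K] pays for the error of two velocities on a spread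
   constraint, the second term for the error on the sphere, and 1 makes the comparison strict. *)
pose c := 2 * K + n%:R * K * D ^+ 2 / E0 + 1.
suff main eps : 0 < eps -> phi t i - phi t j < D * (1 + eps * expR (c * t)).
  apply/ler_addgt0Pr => e e0.
  have ex0 := expR_gt0 (c * t).
  have /main/ltW : 0 < e / (D * expR (c * t)) by rewrite divr_gt0// mulr_gt0.
  congr (_ <= _); field; by rewrite !gt_eqF.
move=> eps0; pose b s := 1 + eps * expR (c * s).
have b1 s : 1 < b s by rewrite ltrDl mulr_gt0// expR_gt0.
have db (s : R) : is_derive s 1 b (c * (b s - 1)).
  have d1 : is_derive s 1 (fun x : R => c * x) c.
    exact: is_derive_eq (is_deriveZ c (is_derive_id s 1)) (mulr1 c).
  have d2 := is_derive1_comp (is_derive_expR (c * s)) d1.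
  have d3 : is_derive s 1 b (0 + eps *: (expR (c * s) * c)).
    exact: is_deriveD (is_derive_cst (1 : R) s 1) (is_deriveZ eps d2).
  apply: is_derive_eq d3 _.
  by rewrite /b /GRing.scale /=; ring.
have cb (s : R) : b @ s --> b s.
  apply: differentiable_continuous; apply/derivable1_diffP; by have [] := db s.
(* One finite family of barrier functions: [Some (k, l)] stands for the spread constraint on an
   ordered pair, [None] for the sum of squares; all are negative strictly inside the dilated set. *)
pose g (o : option ('I_n * 'I_n)) s :=
  if o is Some p then phi s p.1 - phi s p.2 - D * b s else sumsq (phi s) - E0 * b s ^+ 2.
pose F s := kuramoto_rhs adj K w (phi s).
pose dg (o : option ('I_n * 'I_n)) s :=
  if o is Some p then F s p.1 - F s p.2 - D * (c * (b s - 1))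
  else \sum_k 2 * phi s k * F s k - E0 * (2 * b s * (c * (b s - 1))).
suff : g (Some (i, j)) t < 0 by rewrite /g /= subr_lt0.
apply: (@barrier R _ g dg) => //.
- move=> [[k l]|].
    apply: cvgB; first exact: cvgB.
    by apply: cvgM; [exact: cvg_cst | exact: cvg_at_right_filter].
  apply: cvgB; first by apply: cvg_sumr => k _; exact: cvgM.
  apply: cvgM; first exact: cvg_cst.
  by apply: cvgM; exact: cvg_at_right_filter.
- move=> [[k l]|] s s0.
    by apply: is_deriveB; apply: is_deriveB; exact: dphi.
  apply: is_deriveB.
    apply: is_derive_sum_fun => k _.
    apply: is_derive_eq (is_deriveM (dphi s k s0) (dphi s k s0)) _.
    by rewrite /F /GRing.scale /=; ring.
  apply: is_derive_eq (is_deriveZ E0 (is_deriveM (db s) (db s))) _.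
  by rewrite /GRing.scale /=; ring.
- move=> [[k l]|] /=.
    by rewrite subr_lt0 (le_lt_trans (pD k l))// ltr_pMr.
  by rewrite subr_lt0 -/E0 ltr_pMr// exprn_egt1.
(* [y] is the state scaled back to the undilated set, on whose boundary the hypotheses on [K]
   apply. *)
move=> o s s0 gs go; pose y k := phi s k / b s.
have bs0 : 0 < b s := lt_trans ltr01 (b1 s).
have pE k : phi s k = b s * y k by rewrite mulrCA divff ?mulr1 ?gt_eqF.
have yD k l : y k - y l <= D.
  by have := gs (Some (k, l)); rewrite /g /= subr_le0 !pE -mulrBr mulrC ler_pM2r.
have y0 : \sum_k y k = 0 by rewrite -mulr_suml sum0 ?mul0r// ltW.
have sqE : sumsq (phi s) = b s ^+ 2 * sumsq y.
  by rewrite /sumsq mulr_sumr; apply: eq_bigr => k _; rewrite pE exprMn.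
have yE : sumsq y <= E0.
  by have := gs None; rewrite /g subr_le0 sqE mulrC ler_pM2r// exprn_gt0.
have lip k : `|F s k - kuramoto_rhs adj K w y k| <= K * (D * (b s - 1)).
  apply: kuramoto_rhs_lip => [||l]; first exact: ltW.
    by rewrite mulr_ge0 ?ltW// subr_gt0.
  have -> : phi s l - phi s k - (y l - y k) = (b s - 1) * (y l - y k) by rewrite !pE; ring.
  rewrite normrM gtr0_norm ?subr_gt0// [leRHS]mulrC ler_pM2l ?subr_gt0//.
  by rewrite ler_norml yD andbT lerNl opprB yD.
have c2K : 2 * K < c.
  rewrite /c -addrA ltrDl ltr_wpDl// divr_ge0 ?(ltW E00)//.
  by rewrite !mulr_ge0 ?sqr_ge0 ?ler0n ?ltW.
have := b1 s; set B := b s in go bs0 pE sqE lip *; rewrite -subr_gt0 => B1.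
case: o go => [[k l]|] /= go.
- have ykl : y k = y l + D.
    move: go; rewrite /g /= !pE -/B => go.
    apply: (mulfI (lt0r_neq0 bs0)); rewrite mulrDr; lra.
  (* As [y k - y l] is exactly [D] and no difference exceeds [D], [y k] is maximal and [y l]
     minimal. *)
  have fy : feasible D E0 k l y.
    by split=> //; split=> //; split=> // m; have := yD k m; have := yD m l; lra.
  have := kuramoto_gap K0 D0 Dpi hK1 fy.
  have := lip k; have := lip l; rewrite !ler_norml => /andP[h1 h2] /andP[h3 h4] h5.
  have : 2 * K * (D * (B - 1)) < c * (D * (B - 1)) by rewrite ltr_pM2r// mulr_gt0.
  rewrite /dg /= -/B; lra.
(* The active constraint puts [y] on the sphere of the initial sum of squares, for which the
   threshold [hK2] is stated. *)
- have yEE : sumsq y = E0.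
    apply: (mulfI (lt0r_neq0 (exprn_gt0 2 bs0))); move: go; rewrite /g sqE -/B; lra.
  rewrite -yEE in hK2 E00.
  have hen := kuramoto_energy sg conn K0 D0 Dpi yD y0 E00 hK2.
  have yn k : `|y k| <= D by exact: sum0_norm_le.
  have hS : \sum_k y k * F s k <= n%:R * (D * (K * (D * (B - 1)))).
    apply: (@le_trans _ _ (\sum_k (y k * kuramoto_rhs adj K w y k + D * (K * (D * (B - 1)))))).
      apply: ler_sum => k _; rewrite -lerBlDl -mulrBr.
      by apply: le_trans (ler_norm _) _; rewrite normrM ler_pM.
    by rewrite big_split/= sumr_const card_ord [leRHS]mulr_natl gerDr.
  rewrite /dg -/B.
  have -> : \sum_k 2 * phi s k * F s k = 2 * B * \sum_k y k * F s k.
    by rewrite mulr_sumr; apply: eq_bigr => k _; rewrite pE -/B; ring.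
  have -> : E0 * (2 * B * (c * (B - 1))) = 2 * B * (E0 * c * (B - 1)) by ring.
  rewrite -mulrBr pmulr_rlt0 ?mulr_gt0// subr_lt0; apply: le_lt_trans hS _.
  rewrite yEE in E00.
  have -> : E0 * c * (B - 1) = n%:R * (D * (K * (D * (B - 1)))) + E0 * (2 * K + 1) * (B - 1).
    by rewrite /c; field; rewrite gt_eqF.
  by rewrite ltrDl !mulr_gt0// addr_gt0// mulr_gt0.
Qed.

(** * Gradient structure and convergence to the equilibria *)

(** The field is minus the gradient of this function; the division by 2 compensates for each edge
    being counted in both directions. *)
Lemma kuramoto_potential (R : realType) (n : nat) (adj : rel 'I_n) (K : R) (w : 'I_n -> R)
    (phi : R -> 'I_n -> R) (t : R) :
  symmetric adj ->
  (forall i, is_derive t 1 (fun s => phi s i) (kuramoto_rhs adj K w (phi t) i)) ->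
  is_derive t 1 (fun s => - \sum_i w i * phi s i
      - K / n%:R / 2 * \sum_i \sum_(k | adj i k) cos (phi s k - phi s i))
    (- \sum_i kuramoto_rhs adj K w (phi t) i ^+ 2).
Proof.
move=> sym dphi; set F := kuramoto_rhs adj K w (phi t).
have d1 : is_derive t 1 (fun s => \sum_i w i * phi s i) (\sum_i w i * F i).
  by apply: is_derive_sum_fun => i _; exact: (is_deriveZ (w i) (dphi i)).
have d2 : is_derive t 1 (fun s => \sum_i \sum_(k | adj i k) cos (phi s k - phi s i))
    (\sum_i \sum_(k | adj i k) - sin (phi t k - phi t i) * (F k - F i)).
  by apply: is_derive_sum_fun => i _; apply: is_derive_sum_fun => k _.
apply: is_derive_eq (is_deriveB (is_deriveN d1) (is_deriveZ (K / n%:R / 2) d2)) _.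
rewrite /GRing.scale /=.
have -> : \sum_i F i ^+ 2 = \sum_i w i * F i +
    K / n%:R * \sum_i F i * \sum_(k | adj i k) sin (phi t k - phi t i).
  rewrite mulr_sumr -big_split/=; apply: eq_bigr => i _.
  by rewrite mulrCA [w i * _]mulrC -mulrDr expr2.
rewrite (sum_mul_sin_sym F (phi t) sym).
have -> : \sum_i \sum_(k | adj i k) - sin (phi t k - phi t i) * (F k - F i) =
    - \sum_i \sum_(k | adj i k) (F i - F k) * sin (phi t i - phi t k).
  rewrite -sumrN; apply: eq_bigr => i _; rewrite -sumrN; apply: eq_bigr => k _.
  by rewrite -[phi t k - phi t i]opprB sinN; ring.
ring.
Qed.

Lemma kuramoto_velocity_to0 (R : realType) (n : nat) (adj : rel 'I_n) (K D : R) (w : 'I_n -> R)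
    (phi : R -> 'I_n -> R) :
  symmetric adj -> 0 < K ->
  (forall (t : R) i, 0 < t ->
     is_derive t 1 (fun s => phi s i) (kuramoto_rhs adj K w (phi t) i)) ->
  (forall t i, 0 < t -> `|phi t i| <= D) ->
  forall d, 0 < d -> exists2 T, 0 <= T &
    forall t, T < t -> \sum_i kuramoto_rhs adj K w (phi t) i ^+ 2 < d.
Proof.
move=> sym K0 dphi bphi.
pose F t := kuramoto_rhs adj K w (phi t).
pose W := \sum_j `|w j| + K.
have W0 : 0 < W by rewrite ltr_wpDl// sumr_ge0.
have FW t i : `|F t i| <= W by apply: kuramoto_rhs_bound; exact: ltW.
have phil s t i : 0 < s -> s <= t -> `|phi t i - phi s i| <= W * (t - s).
  move=> s0 st.
  have [||c _ ->] := @MVT_segment R (fun t => phi t i) (fun t => F t i) s t st.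
  - by move=> x; rewrite in_itv/= => /andP[sx _]; apply: dphi; exact: lt_trans sx.
  - apply: derivable_within_continuous => x; rewrite in_itv/= => /andP[sx _].
    by have [] := dphi x i (lt_le_trans s0 sx).
  by rewrite normrM [`|t - s|]ger0_norm ?subr_ge0// ler_wpM2r ?subr_ge0.
have Fl s t i : 0 < s -> s <= t -> `|F t i - F s i| <= K * (2 * W * (t - s)).
  move=> s0 st; apply: kuramoto_rhs_lip => [||k]; first exact: ltW.
    by rewrite mulr_ge0 ?subr_ge0// mulr_ge0// ltW.
  have -> : phi t k - phi t i - (phi s k - phi s i) = (phi t k - phi s k) - (phi t i - phi s i).
    by ring.
  apply: le_trans (ler_normB _ _) _; have := phil s t k s0 st; have := phil s t i s0 st; lra.
(* Speeds are at most [W], so phase differences are [2 * W]-Lipschitz in time and each velocity is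
   [2 * K * W]-Lipschitz; factoring a difference of squares gives another [2 * W]. The added 1 keeps
   [Lam] positive even if [n = 0]. *)
pose Lam := n%:R * (4 * K * W ^+ 2) + 1.
apply: (@barbalat R _ _ (- (\sum_i `|w i| * D) -
    K / n%:R / 2 * \sum_(i < n) \sum_(k | adj i k) 1) Lam).
- by move=> t t0; apply: kuramoto_potential => // i; exact: dphi.
- by move=> t _; apply: sumr_ge0 => i _; exact: sqr_ge0.
- move=> t t0; apply: lerB.
    rewrite lerN2; apply: ler_sum => i _; apply: le_trans (ler_norm _) _.
    by rewrite normrM ler_wpM2l// bphi.
  rewrite ler_wpM2l ?divr_ge0 ?(ltW K0)//.
  by apply: ler_sum => i _; apply: ler_sum => k _; exact: cos_le1.
- by rewrite ltr_wpDl// mulr_ge0// mulr_ge0 ?sqr_ge0// mulr_ge0// ltW.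
move=> s t s0 st; rewrite -sumrB; apply: le_trans (ler_norm_sum _ _ _) _.
apply: (@le_trans _ _ (\sum_(i < n) 4 * K * W ^+ 2 * (t - s))); last first.
  by rewrite sumr_const card_ord -[leLHS]mulr_natl [leLHS]mulrA ler_wpM2r ?subr_ge0// lerDl.
apply: ler_sum => i _.
have -> : 4 * K * W ^+ 2 * (t - s) = K * (2 * W * (t - s)) * (W + W) by ring.
rewrite subr_sqr normrM ler_pM ?Fl//.
by apply: le_trans (ler_normD _ _) _; apply: lerD; exact: FW.
Qed.

Lemma cvg_sum_sqr (R : realType) (T : Type) (F : set_system T) (n : nat)
    (f : 'I_n -> T -> R) (a : 'I_n -> R) : Filter F ->
  (forall i, f i x @[x --> F] --> a i) ->
  \sum_i f i x ^+ 2 @[x --> F] --> \sum_i a i ^+ 2.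
Proof. by move=> FF fa; apply: cvg_sumr => i _; exact: cvgM. Qed.

Lemma kuramoto_rhs_cvg (R : realType) (n : nat) (adj : rel 'I_n) (K : R) (w : 'I_n -> R)
    (T : Type) (F : set_system T) (x : T -> 'I_n -> R) (a : 'I_n -> R) (i : 'I_n) :
  Filter F -> (forall k, x t k @[t --> F] --> a k) ->
  kuramoto_rhs adj K w (x t) i @[t --> F] --> kuramoto_rhs adj K w a i.
Proof.
move=> FF xa; apply: cvgD; first exact: cvg_cst.
apply: cvgM; first exact: cvg_cst.
apply: cvg_sumr => k _.
apply: (@cvg_comp _ _ _ (fun t => x t k - x t i) sin); last exact: continuous_sin.
exact: cvgB.
Qed.

(** The points of the cube at distance at least [eps] from every equilibrium form a compact set [A],
    and [d] is the minimum there of the squared speed. If there were no equilibria, [A] would be the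
    whole cube and no point of it would have squared speed below [d]; so the argument itself yields
    the existence of [psi]. *)
Lemma near_equilibrium (R : realType) (n : nat) (adj : rel 'I_n) (K D eps : R) (w : 'I_n -> R) :
  0 < eps -> exists2 d, 0 < d & forall x : 'I_n -> R, (forall i, `|x i| <= D) ->
    \sum_i kuramoto_rhs adj K w x i ^+ 2 < d ->
    exists psi : 'I_n -> R, (forall i, kuramoto_rhs adj K w psi i = 0) /\
       Num.sqrt (\sum_i (x i - psi i) ^+ 2) < eps.
Proof.
move=> eps0.
pose eq := [set psi : 'I_n -> R | forall i, kuramoto_rhs adj K w psi i = 0].
pose far := \bigcap_(psi in eq) [set v : 'rV[R]_n | eps ^+ 2 <= \sum_i (v ord0 i - psi i) ^+ 2].
pose A := [set v : 'rV[R]_n | forall i, `[- D, D]%classic (v ord0 i)] `&` far.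
pose h (v : 'rV[R]_n) := \sum_i kuramoto_rhs adj K w (v ord0) i ^+ 2.
have cA : compact A.
  apply: compact_closedI.
    by apply: (@rV_compact R n (fun=> `[- D, D]%classic)) => i; exact: segment_compact.
  apply: closed_bigI => psi _.
  apply: (@preimage_closed _ _ (fun v : 'rV[R]_n => \sum_i (v ord0 i - psi i) ^+ 2)
    [set y | eps ^+ 2 <= y]); last exact: closed_ge.
  move=> v _; apply: (cvg_sum_sqr (nbhs_filter v)) => i.
  apply: (@cvgB _ _ _ _ (nbhs_filter v)); first exact: coord_continuous.
  exact: (@cvg_cst _ _ _ _ (nbhs_filter v)).
have ch : continuous h.
  move=> v; apply: (cvg_sum_sqr (nbhs_filter v)) => i.
  apply: (@kuramoto_rhs_cvg _ _ _ _ _ _ _ (fun v : 'rV[R]_n => v ord0) _ _ (nbhs_filter v)).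
  by move=> k; exact: coord_continuous.
have notfar x : (forall i, `|x i| <= D) -> ~ A (\row_i x i) ->
    exists psi : 'I_n -> R, (forall i, kuramoto_rhs adj K w psi i = 0) /\
       Num.sqrt (\sum_i (x i - psi i) ^+ 2) < eps.
  move=> xD nA; apply: contrapT => /forallNP nex; apply: nA; split=> [i|psi eqpsi] /=.
    by rewrite in_itv/= mxE -ler_norml.
  have := nex psi; move=> /not_andP[//|/negP]; rewrite -leNgt => h1.
  under eq_bigr do rewrite mxE.
  rewrite -[leRHS]sqr_sqrtr; last by apply: sumr_ge0 => i _; exact: sqr_ge0.
  by rewrite ler_pXn2r// nnegrE ?sqrtr_ge0// ltW.
have hrow (x : 'I_n -> R) : h (\row_i x i) = \sum_i kuramoto_rhs adj K w x i ^+ 2.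
  apply: eq_bigr => i _; congr (kuramoto_rhs _ _ _ _ _ ^+ 2).
  by apply/funext => k; rewrite mxE.
(* If [A] is empty, every point of the cube is close to an equilibrium and any [d] will do. *)
have [A0|/set0P/negP/negPn/eqP A0] := pselect (A !=set0); last first.
  by exists 1 => // x xD _; apply: notfar => //; rewrite A0.
have [v vA vmin] := compact_EVT_min A0 cA (continuous_subspaceT ch).
move: vA; rewrite inE => -[_ vfar].
have hv0 : 0 <= h v by apply: sumr_ge0 => i _; exact: sqr_ge0.
(* A zero minimum would make [v] an equilibrium, at distance 0 from itself, against [vfar]. *)
exists (h v).
  rewrite lt_neqAle hv0 andbT; apply/eqP => /esym/eqP.
  rewrite psumr_eq0 => [/allP h0|i _]; last exact: sqr_ge0.
  have : eq (v ord0) by move=> i; have := h0 i (mem_index_enum _); rewrite sqrf_eq0 => /eqP.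
  move=> /vfar /=; under eq_bigr do rewrite subrr expr0n.
  by rewrite big1// leNgt exprn_gt0.
move=> x xD hx; apply: notfar => // Ax.
by have := vmin (\row_i x i); rewrite inE => /(_ Ax); rewrite hrow leNgt hx.
Qed.

Theorem theorem2 (R : realType) (n : nat) (adj : rel 'I_n)
  (K : R) (w : 'I_n -> R) (phi : R -> 'I_n -> R) (D : R) :
  simple_graph adj ->
  connected_graph adj ->
  0 < K ->
  \sum_(i < n) w i = 0 ->
  (* phi is a solution for t >= 0 *)
  (forall i : 'I_n, (fun t => phi t i) @ at_right (0:R) --> phi 0 i) ->
  (forall (t : R) (i : 'I_n), 0 < t ->
     is_derive t 1 (fun s => phi s i) (kuramoto_rhs adj K w (phi t) i)) ->
  \sum_(i < n) phi 0 i = 0 ->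
  0 < spread (phi 0) ->
  spread (phi 0) <= D ->
  D < pi ->
  sumsq (phi 0) < D ^+ 2 ->
  (Kstar adj w D (sumsq (phi 0%R)) <= K%:E)%E ->
  Num.sqrt (sumsq w) * D /
      (Num.sqrt (sumsq (phi 0)) * Lconst R adj * sin D) <= K ->
  (forall t : R, 0 <= t -> spread (phi t) <= D) /\
  (forall eps : R, 0 < eps -> exists T : R, forall t : R, T < t ->
     exists psi : 'I_n -> R,
       (forall i : 'I_n, kuramoto_rhs adj K w psi i = 0) /\
       Num.sqrt (\sum_(i < n) (phi t i - psi i) ^+ 2) < eps).
Proof.
move=> sg conn K0 w0 c0 dphi p0 s0 sD Dpi _ hK1 hK2.
have D0 : 0 < D := lt_le_trans s0 sD.
have inv := kuramoto_invariant sg conn K0 w0 c0 dphi p0 D0 Dpi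
  ((spread_le _ (ltW D0)).1 sD) (sumsq_spread_gt0 s0) hK1 hK2.
split=> [t t0|eps eps0]; first by apply/spread_le; [exact: ltW | exact: inv].
have bphi t i : 0 < t -> `|phi t i| <= D.
  move=> /ltW t0; apply: sum0_norm_le; first exact: inv.
  exact: kuramoto_sum0 sg.1 w0 c0 dphi p0 _ t0.
have [d d0 hd] := near_equilibrium adj K D w eps0.
have [T T0 hT] := kuramoto_velocity_to0 sg.1 K0 dphi bphi d0.
exists T => t Tt; apply: hd; last exact: hT.
by move=> i; apply: bphi; exact: le_lt_trans Tt.
Qed.
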